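(* Let $A=JL\in\mathrm{GH}(2n)$ with $J\in\mathrm{SS}(2n)$ and $L\in\mathrm{SPD}(2n)$ (so the system $(A,B,C)$ is pure marginally stable). Let $k\le n$, $J_\Omega=-J^{-1}$, and let $J_\Pi\in\mathrm{SS}(2k)$ be arbitrary. Let $(\tilde A,\tilde B,\tilde C)$ be constructed by symplectic projection with $J_\Omega$ and $J_\Pi$, i.e. $\Phi\in\mathrm{Sp}(J_\Omega,J_\Pi)$, $\Psi=J_\Omega\Phi J_\Pi^{-1}$, $\tilde A=\Psi^{\tau}A\Phi$, $\tilde B=\Psi^{\tau}B$, $\tilde C=C\Phi$. Then the reduced system remains pure marginally stable, i.e. $\tilde A\in\mathrm{GH}(2k)$.
   Context: $\mathrm{GH}(m)$ is the set of real $m\times m$ matrices that are diagonalizable (over $\mathbb{C}$) with all eigenvalues nonzero and purely imaginary; an LTI system $(A,B,C)$ (that is, $\dot x=Ax+Bu$, $y=Cx$) with $A\in\mathbb{R}^{m\times m}$ is pure marginally stable if $A\in\mathrm{GH}(m)$. $\mathrm{SPD}(m)$: real symmetric positive-definite $m\times m$ matrices. $\mathrm{SS}(m)$: real nonsingular skew-symmetric $m\times m$ matrices. For $J_\Omega\in\mathrm{SS}(2n)$, $J_\Pi\in\mathrm{SS}(2k)$, $k\le n$, $\mathrm{Sp}(J_\Omega,J_\Pi)$ is the set of real full-column-rank $2n\times2k$ matrices $V$ with $V^{\tau}J_\Omega V=J_\Pi$. $\tau$ denotes transpose. $B\in\mathbb{R}^{2n\times p}$ and $C\in\mathbb{R}^{q\times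 2n}$ are arbitrary. *)

(* Defs.v *)
From HB Require Import structures.
From mathcomp Require Import all_boot all_order all_algebra.
From mathcomp Require Export complex reals.

Set Implicit Arguments.
Unset Strict Implicit.
Unset Printing Implicit Defensive.

Import Order.TTheory GRing.Theory Num.Theory.
Local Open Scope ring_scope.

(* Here [eigenvalue] counts left (row) eigenvectors; for a square matrix this
   gives the same eigenvalues as right eigenvectors. *)
Definition GH (R : realType) (m : nat) (A : 'M[R]_m) : Prop :=
  let AC : 'M[R[i]]_m := map_mx (real_complex R) A in
  diagonalizable AC /\
  (forall lambda : R[i],
      eigenvalue AC lambda -> lambda != 0 /\ complex.Re lambda = 0).

Definition SPD (R : realType) (m : nat) (L : 'M[R]_m) : Prop :=
  L^T = L /\ (forall x : 'cV[R]_m, x != 0 -> 0 < (x^T *m L *m x) 0 0).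

Definition SS (R : realType) (m : nat) (J : 'M[R]_m) : Prop :=
  J^T = - J /\ J \in unitmx.

(* [row_full V] says that the rank of V is its number of columns, i.e. that V
   has full column rank. *)
Definition Sp (R : realType) (n k : nat)
    (JOmega : 'M[R]_(2 * n)) (JPi : 'M[R]_(2 * k))
    (V : 'M[R]_(2 * n, 2 * k)) : Prop :=
  row_full V /\ V^T *m JOmega *m V = JPi.

(* The system x' = A x + B u, y = C x, with p inputs and q outputs. *)
Record lti (R : realType) (m p q : nat) := LTI {
  sysA : 'M[R]_m;
  sysB : 'M[R]_(m, p);
  sysC : 'M[R]_(q, m)
}.

Definition pure_marginally_stable (R : realType) (m p q : nat)
    (S : lti R m p q) : Prop := GH (sysA S).

(* [invmx JPi] is the true inverse only when JPi is nonsingular. *)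
Definition symplectic_projection (R : realType) (n k p q : nat)
    (JOmega : 'M[R]_(2 * n)) (JPi : 'M[R]_(2 * k))
    (Phi : 'M[R]_(2 * n, 2 * k)) (S : lti R (2 * n) p q) : lti R (2 * k) p q :=
  let Psi := JOmega *m Phi *m invmx JPi in
  LTI (Psi^T *m sysA S *m Phi) (Psi^T *m sysB S) (sysC S *m Phi).

(* Main.v *)
(* The inverse of [J] cancels in the projected matrix, which becomes
   [(- JPi^-1) (Phi^T L Phi)]: again a nonsingular skew-symmetric matrix times a
   symmetric positive-definite one.  Over the complex numbers any such product
   [J H] is of the required kind: factoring [H = T^* T] gives
   [T (J H) = (T J T^* ) T], so [J H] is similar to a skew-Hermitian, hence
   normal, hence diagonalizable matrix; and its eigenvalues are quotients of a
   positive number by a purely imaginary one. *)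
Require Import Defs.
From mathcomp Require Import all_boot all_order all_algebra.

Import Order.TTheory GRing.Theory Num.Theory.
Local Open Scope ring_scope.
Local Open Scope sesquilinear_scope.

Lemma unitmxN (R : comUnitRingType) m (A : 'M[R]_m) :
  (- A \in unitmx) = (A \in unitmx).
Proof. by rewrite -scaleN1r unitmxZ // unitrN1. Qed.

Lemma invmxN (R : comUnitRingType) m (A : 'M[R]_m) :
  A \in unitmx -> invmx (- A) = - invmx A.
Proof.
by move=> Au; rewrite -scaleN1r invmxZ ?unitmxZ ?unitrN1 // invrN1 scaleN1r.
Qed.

Section HermitianPositive.
Set Implicit Arguments.
Unset Strict Implicit.
Variable C : numClosedFieldType.

Lemma trmxC_mul m p q (A : 'M[C]_(m, p)) (B : 'M[C]_(p, q)) :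
  (A *m B)^t* = B^t* *m A^t*.
Proof. by rewrite trmx_mul map_mxM. Qed.

Variable n : nat.
Implicit Types J H : 'M[C]_n.

(** The spectral theorem gives [H = P^t* *m diag_mx d *m P] with [P] unitary; positivity of [d] lets
    half of each eigenvalue, as a square root, be absorbed on either side. *)
Lemma posdef_factor H :
  H^t* = H -> (forall v : 'rV[C]_n, v != 0 -> 0 < (v *m H *m v^t*) 0 0) ->
  exists2 T : 'M[C]_n, T \in unitmx & H = T^t* *m T.
Proof.
move=> Hh Hpos; have Hn : H \is normalmx by apply/normalmxP; rewrite Hh.
have /orthomx_spectralP := Hn.
have /unitarymxP PP := spectral_unitarymx H.
rewrite invmx_unitary ?spectral_unitarymx //.
move: (spectralmx H) (spectral_diag H) (spectral_unit H) PP => P d Pu PP HE.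
(* [d 0 j] is the value of the Hermitian form at row [j] of [P], which is nonzero since [P] is
   invertible. *)
have dpos j : 0 < d 0 j.
  have rN0 : row j P != 0.
    apply: contraTneq Pu => r0; rewrite unitmxE (expand_det_row _ j).
    rewrite big1 ?unitr0 // => i _.
    by have /rowP/(_ i) := r0; rewrite !mxE => ->; rewrite mul0r.
  suff <- : (row j P *m H *m (row j P)^t*) 0 0 = d 0 j by exact: Hpos.
  transitivity ((P *m H *m P^t*) j j).
    rewrite -row_mul mxE [RHS]mxE; apply: eq_bigr => i _; rewrite ![row _ _ _ _]mxE.
    by rewrite !mxE.
  by rewrite HE !mulmxA PP mul1mx -mulmxA PP mulmx1 mxE eqxx mulr1n.
exists (diag_mx (map_mx sqrtC d) *m P).
  rewrite unitmx_mul Pu andbT unitmxE det_diag unitfE.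
  by apply/prodf_neq0 => j _; rewrite mxE sqrtC_eq0 gt_eqF.
rewrite trmxC_mul tr_diag_mx map_diag_mx mulmxA -(mulmxA _ (diag_mx _)).
rewrite mulmx_diag HE; congr (_ *m diag_mx _ *m _).
apply/rowP => j; rewrite !mxE /= geC0_conj ?sqrtC_ge0 1?ltW //.
by rewrite -expr2 sqrtCK.
Qed.

Lemma skewherm_mul_posdef_diagonalizable J H :
  J^t* = - J -> H^t* = H ->
  (forall v : 'rV[C]_n, v != 0 -> 0 < (v *m H *m v^t*) 0 0) ->
  diagonalizable (J *m H).
Proof.
move=> Jh Hh /(posdef_factor Hh)[T Tu ->].
set K := T *m J *m T^t*.
have Kh : K^t* = - K by rewrite /K !trmxC_mul trmxCK Jh mulNmx mulmxN mulmxA.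
have /orthomx_spectralP KE : K \is normalmx.
  by apply/normalmxP; rewrite Kh mulmxN mulNmx.
have Qu := spectral_unit K.
move: (spectralmx K) (spectral_diag K) Qu KE => Q d Qu KE.
(* With [H] factored, [T *m (J *m H) = K *m T], and [Q] diagonalizes [K], so the product [Q *m T]
   diagonalizes [J *m H]. *)
exists (Q *m T); first by rewrite unitmx_mul Qu.
apply/diagonalizable_forPex; exists d.
apply/simmxP; first by rewrite unitmx_mul Qu.
have -> : Q *m T *m (J *m (T^t* *m T)) = Q *m K *m T by rewrite /K !mulmxA.
by rewrite KE !mulmxA mulmxV // mul1mx.
Qed.

Lemma skewherm_mul_posdef_eigenvalue J H lambda :
  J \in unitmx -> J^t* = - J ->
  (forall v : 'rV[C]_n, v != 0 -> 0 < (v *m H *m v^t*) 0 0) ->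
  eigenvalue (J *m H) lambda -> lambda != 0 /\ lambda^* = - lambda.
Proof.
move=> Ju Jh Hpos /eigenvalueP[v vE v0].
have u0 : v *m J != 0 by rewrite mulmx_free_eq0 ?row_free_unit.
set t := (v *m J *m v^t*) 0 0.
have tC : t^* = - t.
  have -> : t^* = ((v *m J *m v^t*)^t*) 0 0 by rewrite /t !mxE.
  by rewrite !trmxC_mul trmxCK Jh mulNmx mulmxN mulmxA mxE.
(* The form is taken at [v *m J] because [v *m J *m H = lambda *: v]: its positive value is then
   [- (lambda * t)]. *)
have := Hpos _ u0; rewrite trmxC_mul Jh -(mulmxA v J) vE.
rewrite mulNmx mulmxN -scalemxAl mulmxA 2!mxE -/t => s_gt0.
have lt0 : lambda * t != 0 by rewrite -oppr_eq0 gt_eqF.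
move: (lt0); rewrite mulf_eq0 negb_or => /andP[l0 tn0]; split=> //.
(* A positive number is its own conjugate; since conjugation negates [t], it must negate [lambda]
   too. *)
have := geC0_conj (ltW s_gt0); rewrite rmorphN rmorphM /= tC mulrN => /oppr_inj.
by rewrite -mulNr => /(mulIf tn0)/eqP; rewrite eqr_oppLR => /eqP.
Qed.

End HermitianPositive.

Section SkewMulPosdef.
Set Implicit Arguments.
Unset Strict Implicit.
Local Open Scope complex_scope.
Variable R : realType.
Local Notation toC := (map_mx (real_complex R)).

Lemma trmxC_map_real m n (A : 'M[R]_(m, n)) :
  (toC A)^t* = toC A^T.
Proof. by apply/matrixP => i j; rewrite !mxE; exact: conjc_real. Qed.

Lemma SPD_row_gt0 m (L : 'M[R]_m) (x : 'rV[R]_m) :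
  SPD L -> x != 0 -> 0 < (x *m L *m x^T) 0 0.
Proof.
by move=> [_ Lpos] x0; rewrite -{1}(trmxK x); apply: Lpos; rewrite trmx_eq0.
Qed.

(** Writing [v] as [a + i b] with real [a] and [b], the cross terms cancel by symmetry of [L],
    leaving the sum of the real form at [a] and at [b], which are not both zero. *)
Lemma SPD_complex_posdef m (L : 'M[R]_m) (v : 'rV[R[i]]_m) :
  SPD L -> v != 0 -> 0 < (v *m toC L *m v^t*) 0 0.
Proof.
move=> LP v0; have [LT _] := LP.
pose a := map_mx (@complex.Re R) v; pose b := map_mx (@complex.Im R) v.
have vE : v = toC a + 'i%C *: toC b.
  by apply/rowP => j; rewrite !mxE -complexE.
have vC : v^t* = toC a^T - 'i%C *: toC b^T.
  apply/colP => j; rewrite !mxE; case: (v 0 j) => x y.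
  by apply/eqP; rewrite eq_complex /=; simpc.
(* A 1-by-1 matrix equals its transpose. *)
have sym : b *m L *m a^T = a *m L *m b^T.
  have -> : b *m L *m a^T = (b *m L *m a^T)^T.
    by rewrite [b *m L *m a^T]mx11_scalar tr_scalar_mx.
  by rewrite !trmx_mul trmxK LT mulmxA.
suff -> : v *m toC L *m v^t* = toC (a *m L *m a^T + b *m L *m b^T).
  rewrite mxE ltcR mxE.
  have ge0 (x : 'rV[R]_m) : 0 <= (x *m L *m x^T) 0 0.
    have [->|x0] := eqVneq x 0; first by rewrite !mul0mx mxE.
    exact/ltW/SPD_row_gt0.
  have [a0|a0] := eqVneq a 0; last by rewrite ltr_pwDl ?ge0 ?SPD_row_gt0.
  rewrite ltr_pwDr ?ge0 ?SPD_row_gt0 //; apply: contraNneq v0 => b0.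
  by rewrite vE a0 b0 !raddf0 /= addr0.
rewrite vC {1}vE !mulmxDl !mulmxBr -!scalemxAl -!scalemxAr scalerA.
rewrite -!map_mxM sym map_mxD -expr2 sqr_i scaleN1r opprK.
by rewrite [X in _ + X]addrC addrACA addNr addr0.
Qed.

Lemma SS_mul_SPD_GH m (J L : 'M[R]_m) : SS J -> SPD L -> GH (J *m L).
Proof.
move=> [JT Ju] LP; have [LT _] := LP; rewrite /GH map_mxM.
have Jh : (toC J)^t* = - toC J.
  by rewrite trmxC_map_real JT map_mxN.
have Lpos v := @SPD_complex_posdef m L v LP.
split.
  by apply: skewherm_mul_posdef_diagonalizable; rewrite // trmxC_map_real LT.
move=> lambda /(skewherm_mul_posdef_eigenvalue _ Jh Lpos)[|l0 lC].
  by rewrite map_unitmx.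
(* Comparing real parts in [lambda^* = - lambda] gives [x = - x]. *)
split=> //; move: lC; case: (lambda) => x y /eqP.
rewrite eq_complex /= => /andP[/eqP xN _].
by apply/eqP; rewrite -eqNr -xN.
Qed.

(** Full column rank makes [P] injective on column vectors, so the new form at [x] is the old one at
    the nonzero vector [P *m x]. *)
Lemma SPD_congr m q (L : 'M[R]_m) (P : 'M[R]_(m, q)) :
  SPD L -> row_full P -> SPD (P^T *m L *m P).
Proof.
move=> [LT Lpos] Pf; split; first by rewrite !trmx_mul trmxK LT mulmxA.
move=> x x0; rewrite -!mulmxA mulmxA -trmx_mul mulmxA; apply: Lpos.
apply: contraNneq x0 => Px0.
by apply/eqP; apply: (row_full_inj Pf); rewrite mulmx0.
Qed.

Lemma SS_oppV m (J : 'M[R]_m) : SS J -> SS (- invmx J).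
Proof.
move=> [JT Ju]; split; last by rewrite unitmxN unitmx_inv.
by rewrite linearN /= trmx_inv JT invmxN.
Qed.

End SkewMulPosdef.


Theorem theorem4p17 (R : realType) (n k p q : nat)
    (A J L : 'M[R]_(2 * n)) (B : 'M[R]_(2 * n, p)) (C : 'M[R]_(q, 2 * n))
    (JOmega : 'M[R]_(2 * n)) (JPi : 'M[R]_(2 * k))
    (Phi : 'M[R]_(2 * n, 2 * k)) :
  (k <= n)%N ->
  SS J -> SPD L -> A = J *m L ->
  pure_marginally_stable (LTI A B C) ->
  JOmega = - invmx J ->
  SS JPi ->
  Sp JOmega JPi Phi ->
  pure_marginally_stable (symplectic_projection JOmega JPi Phi (LTI A B C)).
Proof.
move=> _ [JT Ju] LP -> _ -> SPi [Pf _].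
have [PT Pu] := SPi.
rewrite /pure_marginally_stable /=.
(* By skew-symmetry of both inverses the transposed factor is [- invmx JPi *m Phi^T *m invmx J],
   whose last factor meets [J]. *)
have -> : (- invmx J *m Phi *m invmx JPi)^T *m (J *m L) *m Phi =
          - invmx JPi *m (Phi^T *m L *m Phi).
  rewrite !trmx_mul linearN /= !trmx_inv JT PT !invmxN // opprK.
  by rewrite -!mulmxA (mulmxA (invmx J)) mulVmx // mul1mx.
exact/SS_mul_SPD_GH/SPD_congr/Pf/LP/SS_oppV.
Qed.
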